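(* Let $\mathcal A$ be a Boolean algebra and $G$ a free filter on $\omega$. Let $\varphi\colon N_G\to St(\mathcal A)$ be a continuous function such that $\varphi^{-1}(\varphi(p_G))=\{p_G\}$. If $G$ does not have the Nikodym property, then $\mathcal A$ does not have the Nikodym property.
   Context: $St(\mathcal A)$ is the Stone space of $\mathcal A$. A measure on $\mathcal A$ is a finitely additive $\mu\colon\mathcal A\to\mathbb R$ of bounded total variation. $\mathcal A$ has the Nikodym property if every sequence of measures on $\mathcal A$ that is pointwise bounded ($\sup_n|\mu_n(A)|<\infty$ for each $A$) is uniformly bounded ($\sup_n\|\mu_n\|<\infty$). For a free filter $G$, $N_G=\omega\cup\{p_G\}$ has points of $\omega$ isolated and neighbourhoods $A\cup\{p_G\}$, $A\in G$, of $p_G$; $G$ has the Nikodym property if there is no sequence of finitely supported measures $\sum_i\alpha_i\delta_{x_i}$ on $N_G$ with norms $\sum|\alpha_i|\to\infty$ and values on every clopen subset of $N_G$ tending to $0$. *)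

(* Defs.v *)
From HB Require Import structures.
From mathcomp Require Import all_boot all_order all_algebra.
From mathcomp Require Import all_classical all_reals all_analysis.

Set Implicit Arguments.
Unset Strict Implicit.
Unset Printing Implicit Defensive.

Import Order.TTheory GRing.Theory Num.Theory.
Import numFieldNormedType.Exports.

Local Open Scope classical_set_scope.
Local Open Scope ring_scope.

(* Boolean algebras are MathComp's complemented distributive lattices with
   bottom and top (the degenerate algebra \bot = \top is not excluded). *)

Record ultrafilter (d : Order.disp_t) (A : ctbDistrLatticeType d) := Ultrafilter {
  ultra_set :> set A;
  ultra_top : ultra_set \top%O;
  ultra_bot : ~ ultra_set \bot%O;
  ultra_meet : forall a b, ultra_set a -> ultra_set b -> ultra_set (a `&` b)%O;
  ultra_up : forall a b, (a <= b)%O -> ultra_set a -> ultra_set b;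
  ultra_compl : forall a, ultra_set a \/ ultra_set (~` a)%O
}.

Definition St (d : Order.disp_t) (A : ctbDistrLatticeType d) : Type :=
  ultrafilter A.

Definition St_basic (d : Order.disp_t) (A : ctbDistrLatticeType d) (a : A) :
  set (St A) := [set u : St A | ultra_set u a].

Section StoneTopology.
Context (d : Order.disp_t) (A : ctbDistrLatticeType d).

HB.instance Definition _ := gen_eqMixin (St A).
HB.instance Definition _ := gen_choiceMixin (St A).

Let St_basic_cover : \bigcup_(B in range (@St_basic d A)) B = setT.
Proof.
apply/seteqP; split=> // u _; exists (St_basic \top%O); first by exists \top%O.
exact: ultra_top.
Qed.

Let St_basic_join (B C : set (St A)) (u : St A) :
  range (@St_basic d A) B -> range (@St_basic d A) C -> B u -> C u ->
  exists D, [/\ range (@St_basic d A) D, D u & D `<=` B `&` C].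
Proof.
move=> [a _ <-] [b _ <-] ua ub; exists (St_basic (a `&` b)%O); split.
- by exists (a `&` b)%O.
- exact: ultra_meet.
- by move=> v vab; split; apply: ultra_up vab; rewrite ?leIl ?leIr.
Qed.

HB.instance Definition _ :=
  isBaseTopological.Build (St A) St_basic_cover St_basic_join.

End StoneTopology.

Definition free_filter (G : pfilter_on nat) : Prop :=
  \bigcap_(B in G) B = set0.

(* [Some n] is the point n of omega and [None] is the point p_G. *)
Definition NG (G : pfilter_on nat) : Type := option nat.

Definition NG_pt (G : pfilter_on nat) : NG G := None.

(* Points [Some n] are isolated; a set containing p_G is open (equivalently, a
   neighbourhood of p_G) iff its trace on omega belongs to G. *)
Definition NG_open (G : pfilter_on nat) : set_system (NG G) :=
  [set U | U (NG_pt G) -> G [set n | U (Some n)]].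

Section NGTopology.
Context (G : pfilter_on nat).

HB.instance Definition _ := Choice.on (NG G).

Let NG_openT : NG_open (G := G) setT.
Proof. by move=> _; exact: filterT. Qed.

Let NG_openI : setI_closed (@NG_open G).
Proof. by move=> U V oU oV [/oU GU /oV GV]; exact: filterI. Qed.

Let NG_open_bigU (I : Type) (f : I -> set (NG G)) :
  (forall i, NG_open (f i)) -> NG_open (\bigcup_i f i).
Proof.
by move=> of_ [i _ /of_]; apply: filterS => n fin; exists i.
Qed.

HB.instance Definition _ :=
  isOpenTopological.Build (NG G) NG_openT NG_openI NG_open_bigU.

End NGTopology.

Definition tot_variation (R : realType) (d : Order.disp_t)
    (A : ctbDistrLatticeType d) (mu : A -> R) : \bar R :=
  ereal_sup [set (\sum_(a <- s) `|mu a|)%:E |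
    s in [set s : seq A | pairwise (fun a b => a `&` b == \bot)%O s]].

Record ba_measure (R : realType) (d : Order.disp_t)
    (A : ctbDistrLatticeType d) := BaMeasure {
  ba_val :> A -> R;
  ba_additive : forall a b : A, (a `&` b = \bot)%O ->
    ba_val (a `|` b)%O = ba_val a + ba_val b;
  ba_bounded : (tot_variation ba_val < +oo)%E
}.

Definition algebra_nikodym (R : realType) (d : Order.disp_t)
    (A : ctbDistrLatticeType d) : Prop :=
  forall mu : nat -> ba_measure R A,
    (forall a : A, (ereal_sup (range (fun n => `|mu n a|%:E)) < +oo)%E) ->
    (ereal_sup (range (fun n => tot_variation (mu n))) < +oo)%E.

(* The weight function c encodes the measure \sum_x c(x) \delta_x; the points
   x are thus pairwise distinct, so that its norm is \sum_x |c(x)|. *)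
Record fs_measure (R : realType) (T : choiceType) := FsMeasure {
  fs_weight : T -> R;
  fs_finite : finite_set [set x | fs_weight x != 0]
}.

Definition fs_val (R : realType) (T : choiceType) (m : fs_measure R T)
  (U : set T) : R := \sum_(x \in U) fs_weight m x.

Definition fs_norm (R : realType) (T : choiceType) (m : fs_measure R T) : R :=
  \sum_(x \in [set: T]) `|fs_weight m x|.

Definition filter_nikodym (R : realType) (G : pfilter_on nat) : Prop :=
  ~ exists m : nat -> fs_measure R (NG G),
      fs_norm (m n) @[n --> \oo] --> +oo /\
      (forall U : set (NG G), clopen U ->
        fs_val (m n) U @[n --> \oo] --> (0 : R)).

(* Main.v *)
Require Import Defs.
From mathcomp Require Import all_boot all_order all_algebra.
From mathcomp Require Import all_classical all_reals all_analysis.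
From mathcomp Require Import lra.

(** Let m_n be measures on N_G witnessing that G is not Nikodym. If the complement
    of F lies in G, then every subset of F is clopen in N_G, so m_n(E) -> 0 for all
    E included in F, and a gliding hump argument bounds |m_n|(F) uniformly in n.
    The images of the m_n under phi may lose their norm, because phi need not be
    injective on omega. Replacing m_n by
      sum_k |m_n({k})| (delta_k - delta_(p_G))
    makes all weights on omega nonnegative, so the only possible cancellation of the
    images is at phi(p_G), whose fibre is {p_G}. The images remain pointwise bounded
    on A by the bound on |m_n|(F), and their norms are unbounded. *)

Set Implicit Arguments.
Unset Strict Implicit.
Unset Printing Implicit Defensive.

Import Order.TTheory Order.CTheory GRing.Theory Num.Theory.
Import numFieldNormedType.Exports.

Local Open Scope classical_set_scope.
Local Open Scope ring_scope.

Lemma ereal_sup_lty_bounded (R : realType) (T : Type) (f : T -> \bar R) :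
  (ereal_sup (range f) < +oo)%E <-> exists M : R, forall t, (f t <= M%:E)%E.
Proof.
split=> [|[M fM]]; last first.
  by apply: (le_lt_trans _ (ltry M)); apply: ge_ereal_sup => _ [t _ <-].
have ubf t : (f t <= ereal_sup (range f))%E by apply: ereal_sup_ubound; exists t.
case: (ereal_sup (range f)) ubf => [M| |] ubf // _; first by exists M.
by exists 0 => t; rewrite (le_trans (ubf t))// leNye.
Qed.

(** * Sums of finitely supported weights *)

Section FinitelySupported.
Context (R : realType).
Implicit Types (w : nat -> R) (P : pred nat) (E F : set nat).

Lemma sum_nat_trunc w P (B K : nat) : (B <= K)%N ->
  (forall i, (B <= i)%N -> w i = 0) ->
  \sum_(0 <= i < K | P i) w i = \sum_(0 <= i < B | P i) w i.
Proof.
move=> BK w0; rewrite (big_cat_nat (leq0n B) BK)/= [X in _ + X]big1_seq ?addr0//.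
by move=> i /andP[_]; rewrite mem_index_iota => /andP[/w0].
Qed.

(** Split [F] by the sign of [w]: the absolute sum is the sum over the nonnegative part minus the
    sum over the negative part, so one of the two carries at least half of it. *)
Lemma exists_half_abs_sum w (r : seq nat) F (c : R) :
  c * 2 < \sum_(i <- r | i \in F) `|w i| ->
  exists2 E, E `<=` F & c <= `|\sum_(i <- r | i \in E) w i|.
Proof.
pose Ep : set nat := [set i | F i /\ 0 <= w i].
pose En : set nat := [set i | F i /\ w i < 0].
have -> : \sum_(i <- r | i \in F) `|w i| =
    \sum_(i <- r | i \in Ep) w i - \sum_(i <- r | i \in En) w i.
  rewrite big_mkcond [X in _ = X - _]big_mkcond [X in _ = _ - X]big_mkcond/=.
  rewrite -sumrB; apply: eq_bigr => i _.
  have -> : (i \in F) = `[< F i >] by [].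
  have -> : (i \in Ep) = `[< F i >] && (0 <= w i).
    by apply/idP/andP; rewrite inE => -[/asboolP].
  have -> : (i \in En) = `[< F i >] && (w i < 0).
    by apply/idP/andP; rewrite inE => -[/asboolP].
  by case: `[< F i >]; case: ltrgt0P => //=; rewrite ?(subr0, sub0r).
set p := \sum_(i <- r | _) _; set n := \sum_(i <- r | _) _ => cpn.
have [cp|cp] := leP c p.
  by exists Ep => [i []//|]; exact: le_trans cp (ler_norm _).
exists En => [i []//|]; rewrite -normrN.
by apply: le_trans (ler_norm _); rewrite -/n; lra.
Qed.

End FinitelySupported.

(** * Gliding hump: setwise convergence to 0 on subsets of [F] bounds the variation on [F] *)

Section GlidingHump.
Context (R : realType) (w : nat -> nat -> R) (B : nat -> nat) (F : set nat).
Hypothesis wB : forall n i, (B n <= i)%N -> w n i = 0.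
Hypothesis w_cvg0 : forall E, E `<=` F ->
  \sum_(0 <= i < B n | i \in E) w n i @[n --> \oo] --> 0.

(** Singletons in [F] are admissible test sets, so each coordinate in [F] tends to 0, and only
    finitely many lie below [K]. *)
Lemma cvg0_initial_variation (K : nat) :
  \sum_(0 <= i < K | i \in F) `|w n i| @[n --> \oo] --> 0.
Proof.
elim: K => [|K IH].
  have -> : (fun n => \sum_(0 <= i < 0 | i \in F) `|w n i|) = fun=> 0.
    by apply/funext => n; rewrite big_geq.
  exact: cvg_cst.
have -> : (fun n => \sum_(0 <= i < K.+1 | i \in F) `|w n i|) =
    fun n => \sum_(0 <= i < K | i \in F) `|w n i|
           + (if K \in F then `|w n K| else 0).
  by apply/funext => n; rewrite big_mkcond big_nat_recr//= -big_mkcond.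
rewrite -[X in _ --> X]addr0; apply: cvgD => //.
case: (boolP (K \in F)) => [KF|_]; last exact: cvg_cst.
suff /cvg_norm : w n K @[n --> \oo] --> 0 by rewrite normr0.
have /w_cvg0 : [set K] `<=` F by move=> _ ->; rewrite inE in KF.
suff e n : \sum_(0 <= i < B n | i \in [set K]) w n i = w n K.
  by under eq_cvg do rewrite e.
(* [K] may lie beyond the support bound [B n], so the range is first enlarged to contain it. *)
rewrite -(@sum_nat_trunc _ _ _ _ (maxn (B n) K.+1)) ?leq_maxl//; last exact: wB.
rewrite -big_filter (bigD1_seq K)/= ?filter_uniq ?iota_uniq//; last first.
  by rewrite mem_filter mem_index_iota leq_maxr mem_set.
rewrite big1_seq ?addr0// => i /andP[iK].
by rewrite mem_filter => /andP[/set_mem/= iK0]; rewrite iK0 eqxx in iK.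
Qed.

(** For large [n] the mass on [F] below [K] is small, while unboundedness makes the total mass on
    [F] large for some such [n]; hence much of it sits beyond [K], and half of that is caught by one
    set [E]. *)
Lemma gliding_hump_step (K : nat) :
  ~ (exists M : R, forall n, \sum_(0 <= i < B n | i \in F) `|w n i| <= M) ->
  exists t : nat * nat * set nat, let: (n, K', E) := t in
    [/\ (K <= n)%N, (K < K')%N, (B n <= K')%N & E `<=` F] /\
    \sum_(0 <= i < K | i \in F) `|w n i| <= 1 /\
    2 <= `|\sum_(K <= i < K' | i \in E) w n i|.
Proof.
move=> unb.
have [N _ smallN] : \forall n \near \oo, \sum_(0 <= i < K | i \in F) `|w n i| <= 1.
  near=> n; apply: le_trans (ler_norm _) _; near: n.
  by apply: (cvgr_norm_le 0 (cvg0_initial_variation K)); rewrite normr0.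
pose var n := \sum_(0 <= i < B n | i \in F) `|w n i|.
have var0 n : 0 <= var n by apply: sumr_ge0.
(* Of a mass above 5, at most 1 lies below [K]; more than 4 remains, and its half gives the hump of
   size 2. If no such [n] existed, 5 plus the finitely many earlier variations would be a bound. *)
have [n nKN bign] : exists2 n, (maxn K N <= n)%N & 5 < var n.
  apply: contrapT => nbig; apply: unb.
  exists (5 + \sum_(0 <= k < maxn K N) var k) => n; rewrite -/(var n).
  have [Hn|Hn] := leqP (maxn K N) n.
    rewrite -[leLHS]addr0 lerD ?sumr_ge0//.
    by rewrite leNgt; apply/negP => ?; apply: nbig; exists n.
  rewrite -[leLHS]add0r lerD// (bigD1_seq n) ?iota_uniq ?mem_index_iota//=.
  by rewrite lerDl sumr_ge0.
have [Kn Nn] : (K <= n)%N /\ (N <= n)%N by apply/andP; rewrite -geq_max.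
have {}smallN := smallN n Nn.
(* [K.+1] makes the block nonempty, and [B n] makes it reach the end of the support of [w n]. *)
pose K' := maxn K.+1 (B n).
have KK' : (K < K')%N by rewrite leq_maxl.
have [|E EF hE] := @exists_half_abs_sum _ (w n) (index_iota K K') F 2.
  move: bign; rewrite /var -(@sum_nat_trunc _ _ _ _ K') ?leq_maxr//; last first.
    by move=> i /wB ->; rewrite normr0.
  rewrite (big_cat_nat (leq0n K) (ltnW KK'))/=; lra.
by exists (n, K', E); split=> //; split=> //; exact: leq_maxr.
Unshelve. all: by end_near. Qed.

(* The humps live on the disjoint blocks [K_j, K_(j+1)); their union E is a
   subset of F on which w_(n_j) stays away from 0. *)
Lemma variation_bounded_of_setwise_cvg0 :
  exists M : R, forall n, \sum_(0 <= i < B n | i \in F) `|w n i| <= M.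
Proof.
apply: contrapT => unb.
have [f fP] := choice (gliding_hump_step^~ unb).
pose Ks := fix Ks j := if j is j'.+1 then (f (Ks j')).1.2 else 0%N.
pose n j := (f (Ks j)).1.1; pose H j := (f (Ks j)).2.
have {}fP j : [/\ (Ks j <= n j)%N, (Ks j < Ks j.+1)%N, (B (n j) <= Ks j.+1)%N
      & H j `<=` F] /\ \sum_(0 <= i < Ks j | i \in F) `|w (n j) i| <= 1 /\
    2 <= `|\sum_(Ks j <= i < Ks j.+1 | i \in H j) w (n j) i|.
  by move: (fP (Ks j)); rewrite /n /H /=; case: (f (Ks j)) => -[].
have Ks_mono : {homo Ks : i j / (i <= j)%N}.
  apply: homo_leq => [//||j]; first by move=> ? ? ?; exact: leq_trans.
  by have [[_ /ltnW]] := fP j.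
have Ks_ge j : (j <= Ks j)%N.
  by elim: j => // j IH; have [[_ + _ _] _] := fP j; exact: leq_ltn_trans.
pose E : set nat := [set i | exists2 j, (Ks j <= i < Ks j.+1)%N & H j i].
have EF : E `<=` F by move=> i [j _]; have [[_ _ _ HF] _] := fP j; exact: HF.
have Eblock j i : (Ks j <= i < Ks j.+1)%N -> (i \in E) = (i \in H j).
  move=> /andP[ji ij]; apply/idP/idP; rewrite !inE; last by exists j; rewrite ?ji.
  move=> [k /andP[ki ik]]; case: (ltngtP k j) => [/Ks_mono|/Ks_mono|-> //].
    by move=> /leq_trans/(_ ji); rewrite leqNgt ik.
  by move=> /leq_trans/(_ ki); rewrite leqNgt ij.
(* Since [N <= Ks N <= n N], the sum of [w (n N)] over [E] is below 1 in absolute value. But block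
   [N] contributes at least 2, the part of [E] below it at most 1, and nothing lies above it. *)
have [N _ smallN] := cvgr0_norm_lt _ (w_cvg0 EF) _ ltr01.
have [[Kn KK BK _] [small big]] := fP N.
have := smallN _ (leq_trans (Ks_ge N) Kn).
rewrite -(@sum_nat_trunc _ _ _ _ (Ks N.+1))//; last exact: wB.
rewrite (big_cat_nat (leq0n _) (ltnW KK))/=.
rewrite (_ : \sum_(Ks N <= i < _ | _) _ =
  \sum_(Ks N <= i < Ks N.+1 | i \in H N) w (n N) i); last first.
  rewrite big_nat_cond [RHS]big_nat_cond; apply: eq_bigl => i.
  by case: (boolP (_ <= _ < _)%N) => //= /Eblock ->.
set x := \sum_(0 <= i < _ | _) _; set y := \sum_(Ks N <= i < _ | _) _ in big *.
have : `|x| <= 1.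
  apply: le_trans small; apply: le_trans (ler_norm_sum _ _ _) _.
  rewrite big_mkcond [leRHS]big_mkcond; apply: ler_sum => i _.
  case: ifPn => [|_]; last by case: ifP.
  by rewrite inE => /EF iF; rewrite mem_set.
have := lerB_normD y x; rewrite addrC; lra.
Qed.

End GlidingHump.

(** * Ultrafilters and their Dirac measures *)

Section Ultrafilters.
Context (R : realType) (d : Order.disp_t) (A : ctbDistrLatticeType d).
Implicit Types (u p : St A) (a b : A).

Lemma ultra_disjoint u a b :
  (a `&` b = \bot)%O -> ultra_set u a -> ultra_set u b -> False.
Proof.
by move=> ab0 ua ub; apply: (@ultra_bot _ _ u); rewrite -ab0; exact: ultra_meet.
Qed.

Lemma ultra_complE u a : ultra_set u (~` a)%O <-> ~ ultra_set u a.
Proof.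
split=> [uca ua|nua]; first exact: (ultra_disjoint (meetxC a) ua uca).
by case: (ultra_compl u a).
Qed.

Lemma ultra_joinE u a b :
  ultra_set u (a `|` b)%O <-> ultra_set u a \/ ultra_set u b.
Proof.
split=> [uab|[]]; [|exact/ultra_up/leUl|exact/ultra_up/leUr].
have [ua|/ultra_complE uca] := pselect (ultra_set u a); [by left|right].
apply: ultra_up (ultra_meet uab uca).
by rewrite meetUl meetxC join0x leIl.
Qed.

(** Ultrafilters are maximal: by complements, an inclusion between two of them is an equality. *)
Lemma ultra_separate u p : u <> p -> exists2 a, ultra_set u a & ~ ultra_set p a.
Proof.
move=> up; apply: contrapT => nsep.
have sub a : ultra_set u a -> ultra_set p a.
  by move=> ua; apply: contrapT => npa; apply: nsep; exists a.
apply: up; have e : ultra_set u = ultra_set p.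
  apply/seteqP; split=> a; first exact: sub.
  by move=> pa; apply: contrapT => /ultra_complE/sub/ultra_complE.
case: u p e {nsep sub} => [U ? ? ? ? ?] [V ? ? ? ? ?] /= e.
by subst V; congr Ultrafilter; exact: Prop_irrelevance.
Qed.

(** Take the join of elements separating each point from [p]; since [p] is prime, it still omits the
    join. *)
Lemma ultra_separate_seq (x : nat -> St A) p (B : nat) :
  (forall i, x i <> p) ->
  exists2 a, (forall i, (i < B)%N -> ultra_set (x i) a) & ~ ultra_set p a.
Proof.
move=> xp; elim: B => [|B [a xa pa]].
  by exists \bot%O => //; exact: ultra_bot.
have [b xb pb] := ultra_separate (xp B).
exists (a `|` b)%O => [i|/ultra_joinE[]//].
rewrite ltnS leq_eqVlt => /predU1P[->|/xa ?]; apply/ultra_joinE; last by left.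
by right.
Qed.

Definition ultra_dirac u a : R := (`[< ultra_set u a >])%:R.

Lemma ultra_dirac_ge0 u a : 0 <= ultra_dirac u a. Proof. exact: ler0n. Qed.

Lemma ultra_diracU u a b : (a `&` b = \bot)%O ->
  ultra_dirac u (a `|` b)%O = ultra_dirac u a + ultra_dirac u b.
Proof.
move=> ab0; rewrite /ultra_dirac -natrD (asbool_equiv_eq (ultra_joinE u a b)).
rewrite asbool_or; case: asboolP => ua; case: asboolP => ub //.
by have := ultra_disjoint ab0 ua ub.
Qed.

Lemma ultra_diracC u a : ultra_dirac u (~` a)%O = 1 - ultra_dirac u a.
Proof.
rewrite /ultra_dirac (asbool_equiv_eq (ultra_complE u a)) asbool_neg.
by case: asboolP; rewrite ?subrr ?subr0.
Qed.

(** An ultrafilter contains at most one of several pairwise disjoint elements. *)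
Lemma sum_ultra_dirac_le1 u (s : seq A) :
  pairwise (fun a b => a `&` b == \bot)%O s -> \sum_(a <- s) ultra_dirac u a <= 1.
Proof.
elim: s => [|a s IH]; first by rewrite big_nil.
rewrite big_cons pairwise_cons => /andP[/allP as0 /IH {}IH].
rewrite {1}/ultra_dirac; case: asboolP => ua; last by rewrite add0r.
rewrite big1_seq ?addr0// => b /andP[_ /as0/eqP ab0]; rewrite /ultra_dirac.
by case: asboolP => // ub; have := ultra_disjoint ab0 ua ub.
Qed.

(** * Sums of dipoles as measures on the algebra *)

Section Dipoles.
Context (x : nat -> St A) (p : St A) (v : nat -> R) (B : nat).

(** The measure $\sum_{i<B} v_i(\delta_{x_i}-\delta_p)$, evaluated on the clopen set of [a]. *)
Definition dipole_sum a : R :=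
  \sum_(0 <= i < B) (ultra_dirac (x i) a - ultra_dirac p a) * v i.

Lemma dipole_sumU a b : (a `&` b = \bot)%O ->
  dipole_sum (a `|` b)%O = dipole_sum a + dipole_sum b.
Proof.
move=> ab0; rewrite /dipole_sum -big_split/=; apply: eq_bigr => i _.
by rewrite !ultra_diracU// -mulrDl addrACA opprD.
Qed.

(** Each dipole has total mass 0. This reduces bounds on elements of [p] to bounds on elements
    outside [p]. *)
Lemma dipole_sumC a : dipole_sum (~` a)%O = - dipole_sum a.
Proof.
rewrite /dipole_sum -sumrN; apply: eq_bigr => i _.
by rewrite !ultra_diracC -mulNr; congr (_ * _); lra.
Qed.

Lemma dipole_sum_off a : ~ ultra_set p a ->
  dipole_sum a = \sum_(0 <= i < B | i \in [set i | ultra_set (x i) a]) v i.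
Proof.
move=> pa; rewrite [RHS]big_mkcond; apply: eq_bigr => i _.
rewrite {2}/ultra_dirac asboolF// subr0 /ultra_dirac.
have -> : (i \in [set i | ultra_set (x i) a]) = `[< ultra_set (x i) a >] by [].
by case: asboolP; rewrite (mul1r, mul0r).
Qed.

(** Each dipole has variation at most 2. *)
Lemma dipole_sum_bounded : (tot_variation dipole_sum < +oo)%E.
Proof.
apply: le_lt_trans (ltry (\sum_(0 <= i < B) 2 * `|v i|)).
apply: ge_ereal_sup => _ [s /= s0 <-]; rewrite lee_fin.
apply: le_trans (_ : \sum_(a <- s) \sum_(0 <= i < B)
    (ultra_dirac (x i) a + ultra_dirac p a) * `|v i| <= _).
  apply: ler_sum => a _; apply: le_trans (ler_norm_sum _ _ _) _.
  apply: ler_sum => i _; rewrite normrM ler_wpM2r//.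
  by apply: le_trans (ler_normB _ _) _; rewrite !ger0_norm ?ultra_dirac_ge0.
rewrite exchange_big/=; apply: ler_sum => i _.
rewrite -mulr_suml ler_wpM2r// big_split/=.
by have := (sum_ultra_dirac_le1 (x i) s0, sum_ultra_dirac_le1 p s0); case; lra.
Qed.

Definition dipole_measure : ba_measure R A :=
  BaMeasure dipole_sumU dipole_sum_bounded.

End Dipoles.
End Ultrafilters.

(** * Total variation, and finitely supported measures on N_G *)

Lemma tot_variation_ge (R : realType) (d : Order.disp_t)
    (A : ctbDistrLatticeType d) (mu : A -> R) (a : A) :
  (`|mu a|%:E <= tot_variation mu)%E.
Proof.
by apply: ereal_sup_ubound; exists [:: a]; rewrite //= big_seq1.
Qed.

Lemma NG_clopen_image (G : pfilter_on nat) (E F : set nat) :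
  E `<=` F -> G (~` F) -> clopen (Some @` E : set (NG G)).
Proof.
move=> EF GF; split; first by move=> -[].
suff : NG_open (~` (Some @` E) : set (NG G)) by rewrite -openC.
move=> _; apply: filterS GF => n nF [k /EF Fk [kn]].
by apply: nF; rewrite -kn.
Qed.

Lemma fsbig_option (R : realType) (f : option nat -> R) (B : nat)
    (U : set (option nat)) : (forall i, (B <= i)%N -> f (Some i) = 0) ->
  \sum_(x \in U) f x = (if None \in U then f None else 0)
    + \sum_(0 <= i < B | i \in [set i | U (Some i)]) f (Some i).
Proof.
move=> f0; rewrite fsbig_mkcond (fsbigE (None :: map Some (index_iota 0 B)))//=.
- rewrite big_mkcond big_cons in_setT big_map; congr (_ + _).
  rewrite [RHS]big_mkcond; apply: eq_bigr => i _; rewrite in_setT /patch.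
  by have -> : (Some i \in U) = (i \in [set i | U (Some i)]) by [].
- rewrite map_inj_uniq ?iota_uniq ?andbT; last by move=> ? ? [].
  by apply/mapP => -[].
- move=> [i|//] _; rewrite inE/= mem_map; last by move=> ? ? [].
  by rewrite mem_index_iota/= -leqNgt /patch => /f0 ->; case: ifP.
Qed.

Lemma fs_measure_support (R : realType) (G : pfilter_on nat)
    (m : fs_measure R (NG G)) :
  exists B, forall i, (B <= i)%N -> fs_weight m (Some i) = 0.
Proof.
have /finite_seqP[r rE] := fs_finite m.
exists (\max_(x <- r) oapp S 0%N x)%N => i; apply: contraTeq => wi.
have ir : Some i \in r by suff : [set` r] (Some i) by []; rewrite -rE.
by rewrite -ltnNge (@leq_bigmax_seq _ r xpredT (oapp S 0%N) (Some i)).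
Qed.

(** * Transfer of the witness from N_G to the algebra *)

Theorem mainTheorem17 (R : realType) (d : Order.disp_t)
    (A : ctbDistrLatticeType d) (G : pfilter_on nat) (hG : free_filter G)
    (phi : NG G -> St A) (phi_cont : continuous phi)
    (phi_fib : phi @^-1` [set phi (NG_pt G)] = [set NG_pt G]) :
  ~ filter_nikodym R G -> ~ algebra_nikodym R A.
Proof.
move=> /contrapT[m [norm_oo val0]] nikA.
have [B mB] := choice (fun n => fs_measure_support (m n)).
pose w n i := fs_weight (m n) (Some i).
pose p := phi (NG_pt G); pose x i := phi (Some i).
pose mu n := dipole_measure x p (fun i => `|w n i|) (B n).
have xp i : x i <> p.
  by move=> xip; suff : [set NG_pt G] (Some i) by []; rewrite -phi_fib.
have trace0 (E F : set nat) : E `<=` F -> G (~` F) ->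
    \sum_(0 <= i < B n | i \in E) w n i @[n --> \oo] --> 0.
  move=> EF GF; have /val0 := NG_clopen_image EF GF.
  suff e n : fs_val (m n) (Some @` E) = \sum_(0 <= i < B n | i \in E) w n i.
    by under eq_cvg do rewrite e.
  rewrite /fs_val (fsbig_option _ (mB n)) memNset ?add0r; last by case.
  apply: eq_bigl => i; congr (i \in _); apply/seteqP; split=> [k [j Ej [<-]]//|].
  by move=> k Ek; exists k.
(* Continuity of [phi]: the preimage of the basic open set of [a] is an open set containing p_G. *)
have trace_open a : ultra_set p a -> G [set i | ultra_set (x i) a].
  move=> pa; have /continuousP/(_ (St_basic a)) op := phi_cont.
  apply: op => //; exists [set St_basic a]; last by rewrite bigcup_set1.
  by move=> _ ->; exists a.
(* The complement of [a] lies in [p], so the trace [F] of [a] has its complement in [G] and the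
   gliding hump bound applies to it. *)
have mu_bounded_off a : ~ ultra_set p a -> exists M : R, forall n, `|mu n a| <= M.
  move=> pa; pose F := [set i | ultra_set (x i) a].
  have GF : G (~` F).
    have /ultra_complE/trace_open := pa.
    by apply: filterS => i /ultra_complE.
  have [M hM] := variation_bounded_of_setwise_cvg0 mB (fun E EF => trace0 E F EF GF).
  exists M => n; rewrite /mu/= dipole_sum_off// ger0_norm ?hM//.
  exact: sumr_ge0.
have /ereal_sup_lty_bounded[M hM] :
    (ereal_sup (range (fun n => tot_variation (mu n))) < +oo)%E.
  apply: nikA => a; apply/ereal_sup_lty_bounded.
  suff [M hM] : exists M : R, forall n, `|mu n a| <= M by exists M.
  have [pa|/mu_bounded_off//] := pselect (ultra_set p a).
  have [|M hM] := mu_bounded_off (~` a)%O; first by move/ultra_complE.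
  by exists M => n; have := hM n; rewrite /mu/= dipole_sumC normrN.
pose var n := \sum_(0 <= i < B n) `|w n i|.
have var_le n : var n <= M.
  (* This [a] contains all the points [x i] with [i < B n] but omits [p], so [mu n a] equals the
     whole mass [var n], even if [phi] identifies points. *)
  have [a xa pa] := ultra_separate_seq (B n) xp.
  have := le_trans (tot_variation_ge (mu n) a) (hM n).
  rewrite lee_fin /mu/= dipole_sum_off// => /(le_trans (ler_norm _)).
  congr (_ <= _); rewrite big_nat_cond [RHS]big_nat; apply: eq_bigl => i.
  by case: (ltnP i (B n)) => //= /xa xia; rewrite mem_set.
have total0 : fs_val (m n) setT @[n --> \oo] --> 0 by apply: val0; exact: clopenT.
near \oo => n.
(* The mass on omega is at most [M]. With a total value below 1 in absolute value, the weight at p_G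
   is below [M + 1], so the norm would be below [M + M + 1]. *)
have : M + M + 1 < fs_norm (m n).
  by near: n; move/cvgryPgt : norm_oo; exact.
have : `|fs_val (m n) setT| < 1.
  by near: n; apply: (cvgr_norm_lt 0 total0); rewrite normr0.
rewrite /fs_norm /fs_val (fsbig_option _ (mB n)).
rewrite (@fsbig_option _ (fun y => `|fs_weight (m n) y|) (B n)); last first.
  by move=> i /mB ->; rewrite normr0.
rewrite !in_setT.
under eq_bigl do rewrite in_setT.
under [X in _ -> _ < _ + X -> _]eq_bigl do rewrite in_setT.
have := var_le n; rewrite /var /w.
have := ler_norm_sum (index_iota 0 (B n)) (w n) xpredT.
rewrite /w; set s := \sum_(0 <= i < B n) fs_weight _ _.
have := lerB_normD (fs_weight (m n) None) s.
lra.
Unshelve. all: by end_near. Qed.
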